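(* Let $n\ge1$ and let $\alpha\vDash n$ be a composition of length $\ell$. Let $\beta^\omega_\alpha$ be the composition with parts $$(\beta^\omega_\alpha)_m=\#\{i\mid \alpha_i-1\ge m\}+\#\{i\mid \max_{j\le i}\{\alpha^r_j\}=m\},\qquad 1\le m\le \max_j\alpha_j.$$ Then the leading term (with respect to the lexicographic order) in the $\mathfrak{S}^*$-expansion of $\omega(\mathfrak{S}^*_\alpha)$ is indexed by $\beta^\omega_\alpha$, and $[\mathfrak{S}^*_{\beta^\omega_\alpha}]\omega(\mathfrak{S}^*_\alpha)=1$. Moreover, there is a unique row-strict semi-standard reverse immaculate tableau $T^{\omega,M}_\alpha$ of shape $\alpha^r$ and content $\beta^\omega_\alpha$, and for every $1\le i\le\ell$ its $i$-th row, read from left to right, is $$\mathrm{Row}_i(T^{\omega,M}_\alpha)=(\max_{j\le i}\{\alpha^r_j\},\ \alpha^r_i-1,\ \dots,2,1).$$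
   Context: A composition $\alpha=(\alpha_1,\dots,\alpha_\ell)\vDash n$ is a finite list of positive integers with sum $n$; $\ell$ is its length. Write $\mathrm{Set}(\alpha)=\{\alpha_1,\alpha_1+\alpha_2,\dots,\alpha_1+\cdots+\alpha_{\ell-1}\}\subseteq[n-1]=\{1,\dots,n-1\}$, and let $\mathrm{Comp}$ be the inverse bijection from subsets of $[n-1]$ to compositions of $n$. The reverse is $\alpha^r=(\alpha_\ell,\dots,\alpha_1)$ with $j$-th part denoted $\alpha^r_j$, the complement is $\alpha^c=\mathrm{Comp}([n-1]\setminus\mathrm{Set}(\alpha))$, and the transpose is $\alpha^t=(\alpha^c)^r$. Lexicographic order on compositions of $n$: $\beta\le_l\alpha$ if $\beta=\alpha$ or $\beta_i<\alpha_i$ at the minimal index $i$ with $\beta_i\ne\alpha_i$. In the variables $x_1,x_2,\dots$, $M_\alpha=\sum_{i_1<\cdots<i_\ell}x_{i_1}^{\alpha_1}\cdots x_{i_\ell}^{\alpha_\ell}$; $\mathrm{QSym}^n$ is the $\mathbb{Z}$-span of $\{M_\alpha\mid\alpha\vDash n\}$, $\mathrm{QSym}=\bigoplus_{n\ge 0}\mathrm{QSym}^n$. The fundamental quasisymmetric functions are $F_\alpha=\sum_{\beta\preceq\alpha}M_\beta$, where $\beta\preceq\alpha$ means that the parts of $\alpha$ are obtained in order by adding adjacent parts of $\beta$; they form a basis. The linear map $\omega:\mathrm{QSym}\to\mathrm{QSym}$ is defined by $\omega(F_\alpha)=F_{\alpha^t}$. The diagram of $\alpha$ is the left-justified array of cells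 with $\alpha_i$ cells in row $i$, rows numbered from bottom to top, columns from left to right. The content of a filling by positive integers is the sequence $\beta$ with $\beta_i$ the number of entries equal to $i$. A semi-standard immaculate tableau of shape $\alpha$ is a filling of the diagram of $\alpha$ by positive integers with entries strictly increasing from bottom to top in the first (leftmost) column and weakly increasing from left to right in each row. A row-strict semi-standard reverse immaculate tableau of shape $\alpha$ is a filling with entries weakly increasing from bottom to top in the first column and strictly increasing from right to left in each row. The dual immaculate function is $\mathfrak{S}^*_\alpha=\sum_{\beta\vDash n}K_{\alpha,\beta}M_\beta$, with $K_{\alpha,\beta}$ the number of semi-standard immaculate tableaux of shape $\alpha$ and content $\beta$; $\{\mathfrak{S}^*_\alpha\}_{\alpha\vDash n}$ is a $\mathbb{Z}$-basis of $\mathrm{QSym}^n$. For a basis element $B$, $[B]G$ denotes the coefficient of $B$ in the expansion of $G$. The leading term of the expansion of a nonzero $G\in\mathrm{QSym}^n$ in a basis indexed by compositions of $n$ is the term with nonzero coefficient whose index is largest in lexicographic order. If $\alpha^r_i=1$, the displayed row consists of the single entry $\max_{j\le i}\{\alpha^r_j\}$. *)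

(* Defs.v *)
From HB Require Import structures.
From mathcomp Require Import all_boot all_order all_algebra.
From mathcomp Require Import finmap multiset.
From mathcomp Require Import all_classical.

Set Implicit Arguments.
Unset Strict Implicit.
Unset Printing Implicit Defensive.

Import GRing.Theory.

Local Open Scope nat_scope.

(** * Compositions

    Sequences are indexed from 0, so the part alpha_(i+1) is [nth 0 alpha i]. *)

Record composition (n : nat) := Composition {
  parts :> seq nat;
  composition_subproof : (0 \notin parts) && (sumn parts == n)
}.

HB.instance Definition _ n := [isSub for @parts n].
HB.instance Definition _ n := [Countable of composition n by <:].

(* Set(alpha), listed in increasing order. *)
Definition comp_set (s : seq nat) : seq nat :=
  [seq sumn (take i s) | i <- iota 1 (size s).-1].

(* The parts of Comp(A), for A a subset of [n-1]: the successive differences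
   of 0, the elements of A in increasing order, and n.  Elements of A outside
   [n-1] are ignored. *)
Definition set_comp_parts (n : nat) (A : {pred nat}) : seq nat :=
  if n is 0 then [::]
  else pairmap (fun x y => y - x) 0 (rcons [seq k <- iota 1 n.-1 | k \in A] n).

Lemma pairmap_subn_path (x : nat) (s : seq nat) : path ltn x s ->
  0 \notin pairmap (fun x y => y - x) x s
  /\ x + sumn (pairmap (fun x y => y - x) x s) = last x s.
Proof.
elim: s x => [|y s IHs] x /=; first by rewrite addn0.
move=> /andP[ltxy /IHs[IH0 IH]]; split; last by rewrite addnA subnKC // ltnW.
by rewrite inE negb_or IH0 eq_sym -lt0n subn_gt0 ltxy.
Qed.

Lemma set_comp_subproof n A :
  (0 \notin set_comp_parts n A) && (sumn (set_comp_parts n A) == n).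
Proof.
case: n => [//|n]; rewrite /set_comp_parts.
set s := [seq k <- _ | _].
have s_sorted : path ltn 0 (rcons s n.+1).
  rewrite rcons_path; apply/andP; split.
    rewrite path_min_sorted; first exact/sorted_filter/iota_ltn_sorted/ltn_trans.
    by apply/allP => k; rewrite mem_filter mem_iota => /andP[_ /andP[]].
  have := mem_last 0 s; rewrite inE => /predU1P[-> //|].
  by rewrite mem_filter mem_iota => /andP[_ /andP[_]]; rewrite add1n.
have [-> ] := pairmap_subn_path s_sorted.
by rewrite add0n last_rcons => ->; rewrite eqxx.
Qed.

Definition set_comp n (A : {pred nat}) : composition n :=
  Composition (set_comp_subproof n A).

Lemma comp_setK n (a : composition n) : set_comp n [pred k | k \in comp_set a] = a.
Proof.
apply: val_inj; case: a => s /= /andP[s_pos /eqP sn].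
rewrite /set_comp_parts; case: n sn => [|n] sn.
  by case: s s_pos sn => [//|[|x] s].
have scanE : rcons (comp_set s) n.+1 = scanl addn 0 s.
  have s0 : 0 < size s by case: s sn {s_pos}.
  apply: (@eq_from_nth _ 0) => [|i].
    by rewrite size_rcons size_map size_iota size_scanl prednK.
  rewrite size_rcons size_map size_iota prednK // => lti.
  rewrite nth_scanl //.
  have foldE t : foldl addn 0 t = sumn t.
    by elim/last_ind: t => // t x IHt; rewrite -cats1 foldl_cat sumn_cat /= IHt addn0.
  rewrite foldE nth_rcons size_map size_iota.
  case: ltnP => [lti'|gei].
    by rewrite (nth_map 0) ?size_iota // nth_iota // add1n.
  have -> : i = (size s).-1 by apply/eqP; rewrite eqn_leq gei -ltnS prednK ?lti.
  by rewrite eqxx prednK // take_size.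
have scan_sorted x t : 0 \notin t -> path ltn x (scanl addn x t).
  elim: t x => [//|y t IHt] x; rewrite inE negb_or => /andP[y0 t0] /=.
  by rewrite IHt // andbT -[X in X < _]addn0 ltn_add2l lt0n eq_sym.
have -> : [seq k <- iota 1 n | k \in [pred k | k \in comp_set s]] = comp_set s.
  apply: (@irr_sorted_eq _ ltn); [exact: ltn_trans|exact: ltnn| | |].
  - exact/sorted_filter/iota_ltn_sorted/ltn_trans.
  - have := scan_sorted 0 _ s_pos; rewrite -scanE rcons_path => /andP[+ _].
    exact: path_sorted.
  - move=> k; rewrite mem_filter mem_iota inE add1n ltnS andb_idr //.
    have := scan_sorted 0 _ s_pos; rewrite -scanE -cats1 cat_path /=.
    move=> ks kin; case/andP: ks => + /andP[+ _].
    move: kin; case/splitPr => p1 p2; rewrite cat_path last_cat /=.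
    move=> /and3P[h1 h2 h3] h4.
    have h0 : 0 < k.
      have := order_path_min ltn_trans (x := 0) (s := rcons p1 k).
      rewrite rcons_path h1 h2 => /(_ isT) /allP; apply.
      by rewrite mem_rcons mem_head.
    rewrite h0 -ltnS /=.
    have := order_path_min ltn_trans (x := k) (s := rcons p2 n.+1).
    rewrite rcons_path h3 h4 => /(_ isT) /allP; apply.
    by rewrite mem_rcons mem_head.
rewrite scanE scanlK // => x y; by rewrite addKn.
Qed.

Lemma comp_set_inj n : pcancel
  (fun a : composition n => [set i : 'I_n | val i \in comp_set a]%SET)
  (fun A => Some (set_comp n [pred k | [exists i in A, val i == k]])).
Proof.
move=> a; congr Some; rewrite -[RHS]comp_setK; apply: val_inj => /=.
rewrite /set_comp_parts; case: n a => // n a.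
congr (pairmap _ _ (rcons _ _)); apply: eq_in_filter => k.
rewrite mem_iota /= add1n ltnS !inE => /andP[_ lekn].
apply/exists_inP/idP => [[i + /eqP <-]|kin]; first by rewrite inE.
by exists (Ordinal (lekn : k < n.+1)); rewrite ?inE.
Qed.

HB.instance Definition _ n : isFinite (composition n) := PCanIsFinite (@comp_set_inj n).

Lemma comp_rev_subproof n (a : composition n) :
  (0 \notin rev a) && (sumn (rev a) == n).
Proof. by rewrite mem_rev sumn_rev; case: a. Qed.

Definition comp_rev n (a : composition n) : composition n :=
  Composition (comp_rev_subproof a).

Definition comp_compl n (a : composition n) : composition n :=
  set_comp n [pred k | k \notin comp_set a].

Definition comp_tr n (a : composition n) : composition n :=
  comp_rev (comp_compl a).

Definition lexle (b a : seq nat) : Prop :=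
  b = a \/
  exists i, (forall j, j < i -> nth 0 b j = nth 0 a j) /\ nth 0 b i < nth 0 a i.

(* The parts of a are the sums of the successive blocks of some splitting of b
   into consecutive blocks. *)
Definition refines (b a : seq nat) : Prop :=
  exists bb : seq (seq nat), flatten bb = b /\ map sumn bb = a.

(** * Quasisymmetric functions

    Formal power series over int in the variables x_0, x_1, ... (the index set
    {1, 2, ...} shifted by one).  A monomial is the finite multiset of its
    variables, and a series is the function giving the coefficient of each
    monomial. *)

Definition monomial : choiceType := {mset nat}%mset.

Definition series : zmodType := monomial -> int.

(* x_(i_1)^(a_1) ... x_(i_l)^(a_l) *)
Definition monom (i a : seq nat) : monomial :=
  \big[msetD/mset0]_(p <- zip i a) msetn p.2 p.1.

Definition M_series (a : seq nat) : series := fun m =>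
  (\sum_(i \in [set i : seq nat | size i = size a /\ sorted ltn i])
     ((monom i a == m)%:R : int))%R.

Definition qsym_pred : {pred series} := fun f =>
  `[< exists s : seq (int * {n & composition n}),
        f = (\sum_(p <- s) M_series (tagged p.2) *~ p.1)%R >].

Lemma qsym_zmod_closed : zmod_closed qsym_pred.
Proof.
split=> [|f g /asboolP[s ->] /asboolP[t ->]]; apply/asboolP.
  by exists [::]; rewrite big_nil.
exists (s ++ [seq (- p.1, p.2)%R | p <- t]).
rewrite big_cat big_map; congr (_ + _)%R.
by rewrite -sumrN; apply: eq_bigr => p _; rewrite mulrNz.
Qed.

HB.instance Definition _ := GRing.isZmodClosed.Build series qsym_pred
  qsym_zmod_closed.

Record qsym := QSym { qsym_val :> series; qsym_valP : qsym_val \in qsym_pred }.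

HB.instance Definition _ := [isSub for qsym_val].
HB.instance Definition _ := [Choice of qsym by <:].
HB.instance Definition _ := [SubChoice_isSubZmodule of qsym by <:].

Lemma M_subproof n (a : composition n) : M_series a \in qsym_pred.
Proof.
apply/asboolP; exists [:: (1%R, Tagged composition a)].
by rewrite big_seq1.
Qed.

Definition QM n (a : composition n) : qsym := QSym (M_subproof a).

Definition QF n (a : composition n) : qsym :=
  (\sum_(b : composition n | `[< refines b a >]) QM b)%R.

(** * Tableaux

    A filling is the list of its rows from bottom to top, each row being listed
    from left to right. *)

Definition filling (a : seq nat) (T : seq (seq nat)) : Prop :=
  shape T = a /\ 0 \notin flatten T.

Definition first_column (T : seq (seq nat)) : seq nat := map (head 0) T.

Definition has_content (T : seq (seq nat)) (b : seq nat) : Prop :=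
  forall i, count_mem i.+1 (flatten T) = nth 0 b i.

Definition ss_immaculate (a : seq nat) (T : seq (seq nat)) : Prop :=
  [/\ filling a T, sorted ltn (first_column T) & all (sorted leq) T].

Definition rs_reverse_immaculate (a : seq nat) (T : seq (seq nat)) : Prop :=
  [/\ filling a T, sorted leq (first_column T) & all (sorted gtn) T].

Definition K (a b : seq nat) : nat :=
  #|` fset_set [set T | ss_immaculate a T /\ has_content T b]|%fset.

Definition dual_immaculate n (a : composition n) : qsym :=
  (\sum_(b : composition n) QM b *+ K a b)%R.

(* The coefficients [B_b]G; meaningful when B is a basis of a subgroup of qsym
   containing G, otherwise an arbitrary expansion of G, or 0 if there is none. *)
Definition qcoef n (B : composition n -> qsym) (G : qsym) : composition n -> int :=
  xget (fun=> 0%R) [set c | G = (\sum_b B b *~ c b)%R].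

Definition leading_index n (B : composition n -> qsym) (G : qsym)
    (b : composition n) : Prop :=
  qcoef B G b <> 0%R /\ forall g, qcoef B G g <> 0%R -> lexle g b.

(* max_{j <= i} s_j *)
Definition running_max (s : seq nat) (i : nat) : nat :=
  \max_(j < i.+1) nth 0 s j.

Definition beta_omega (a : seq nat) : seq nat :=
  [seq #|[pred i : 'I_(size a) | m <= nth 0 a i - 1]|
     + #|[pred i : 'I_(size a) | running_max (rev a) i == m]|
  | m <- iota 1 (\max_(x <- a) x)].

(* Main.v *)
From HB Require Import structures.
Require Import Defs.
From mathcomp Require Import all_boot all_order all_algebra.
From mathcomp Require Import finmap multiset.
From mathcomp Require Import all_classical.
From mathcomp Require Import zify.

Set Implicit Arguments.
Unset Strict Implicit.
Unset Printing Implicit Defensive.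

Import GRing.Theory.

Local Open Scope nat_scope.

(** The proof has three steps.

    Expansion of omega.  A word in the letters 0, ..., l-1, with alpha_(i+1)
    letters i and with the first occurrences of the letters in increasing
    order, is a standard immaculate tableau of shape alpha: its p-th letter is
    the row of the entry p, the rows being numbered from 0.  Sending position p to the letter in position p of
    1...1 2...2 3...3 ..., with beta_j copies of j, turns such a word into a
    filling of content beta, and this filling is semi-standard immaculate
    exactly when every ascent of the word lies in Set(beta).  Hence the dual
    immaculate function of alpha is the sum over words of F_(co w), where co w
    is the composition of the ascent set ([dual_immaculate_F]).  Applying omega
    complements and reverses that set.  The words whose complemented and
    reversed ascent set lies in Set(beta) are, by the same construction with
    the labels placed in decreasing order and the rows turned upside down, the
    row-strict semi-standard reverse immaculate tableaux of shape alpha^r and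
    content beta.  So the coefficient of M_beta in the image under omega counts
    these tableaux ([omega_dual_immaculate]).  Both bijections are instances of
    one statement, [card_is_tableau].

    Extremal content.  In a row of length r of a row-strict reverse immaculate
    tableau, the cells outside the first column hold distinct positive entries,
    at most min(m, r - 1) of them being <= m, and the entry of the first column
    is at least the length of its row and of all the rows below.  The rows of
    the statement attain all these bounds for every m simultaneously.
    Comparing the numbers of entries <= m row by row shows that every content
    is dominated by beta_omega, and that content beta_omega forces equality in
    each row, hence determines the tableau ([reverse_immaculate_dominated],
    [reverse_immaculate_extremal]).

    Change of basis.  The same comparison, against the filling whose i-th row
    is constant equal to i, shows that K is unitriangular for dominance
    ([K_dominated], [K_diag]).  Therefore passing from the M-expansion to the
    expansion in dual immaculate functions preserves a dominance-greatest term
    and its coefficient ([leading_dominated]), and dominance implies the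
    lexicographic order. *)

(** * Compositions, their sets and refinement *)

Lemma comp_set_cons2 x y s :
  comp_set (x :: y :: s) = x :: map (addn x) (comp_set (y :: s)).
Proof.
rewrite /comp_set /= addn0; congr (_ :: _).
rewrite -map_comp (iotaDl 1 1) -map_comp.
by apply: eq_map => i /=.
Qed.

Lemma mem_comp_set s k :
  reflect (exists i, [/\ 0 < i, i < size s & k = sumn (take i s)])
          (k \in comp_set s).
Proof.
apply: (iffP mapP) => [[i]|[i [i0 ilt ->]]].
  by rewrite mem_iota => ? ->; exists i; split=> //; lia.
by exists i => //; rewrite mem_iota; lia.
Qed.

Lemma comp_set_gt0 s k : 0 \notin s -> k \in comp_set s -> 0 < k.
Proof.
case: s => [//|x s]; rewrite inE negb_or => /andP[x0 _].
by case/mem_comp_set => -[|i] [//= _ _ ->]; lia.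
Qed.

Lemma comp_set_pairmap x s n : path ltn x (rcons s n) ->
  comp_set (pairmap (fun x y => y - x) x (rcons s n)) = map (subn^~ x) s.
Proof.
elim: s x => [|y s IHs] x; first by [].
rewrite rcons_cons [path _ _ _]/= => /andP[ltxy pth].
have [z [t E]] : exists z t, rcons s n = z :: t.
  by case: (s) => [|z t]; [exists n, [::]|exists z, (rcons t n)].
have := IHs y pth; rewrite E /= comp_set_cons2 => ->; congr (_ :: _).
rewrite -map_comp; apply/eq_in_map => k ks /=.
have := order_path_min ltn_trans pth.
by move/allP/(_ k); rewrite mem_rcons inE ks orbT => /(_ isT); lia.
Qed.

Lemma mem_comp_set_comp n D k :
  (k \in comp_set (set_comp n D)) = (0 < k < n) && (k \in D).
Proof.
case: n => [|n]; first by rewrite in_nil; case: k.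
rewrite /= /set_comp_parts comp_set_pairmap.
  rewrite (eq_map (g := id)) ?map_id => [|i]; last by rewrite subn0.
  by rewrite mem_filter mem_iota add1n ltnS andbC.
rewrite rcons_path; apply/andP; split.
  rewrite path_min_sorted; first exact/sorted_filter/iota_ltn_sorted/ltn_trans.
  by apply/allP => i; rewrite mem_filter mem_iota => /andP[_ /andP[]].
have := mem_last 0 [seq k <- iota 1 n | k \in D].
rewrite inE => /predU1P[-> //|].
by rewrite mem_filter mem_iota => /andP[_ /andP[_]]; rewrite add1n.
Qed.

Lemma mem_comp_set_rev s k : 0 < k < sumn s ->
  (k \in comp_set (rev s)) = (sumn s - k \in comp_set s).
Proof.
have sub t j : j \in comp_set t -> j <= sumn t ->
    sumn t - j \in comp_set (rev t).
  case/mem_comp_set => i [i0 ilt ->] _; apply/mem_comp_set.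
  exists (size t - i); rewrite size_rev; split; [lia|lia|].
  rewrite take_rev sumn_rev -{1}(cat_take_drop i t) sumn_cat addKn.
  by congr (sumn (drop _ _)); lia.
move=> k0; apply/idP/idP => h.
  by have := sub _ _ h; rewrite revK sumn_rev; apply; lia.
have := sub _ _ h; have -> : sumn s - (sumn s - k) = k by lia.
by apply; lia.
Qed.

Lemma refines_rev b a : refines b a -> refines (rev b) (rev a).
Proof.
move=> [bb [<- <-]]; exists (rev (map rev bb)); split.
  by rewrite rev_flatten.
rewrite map_rev -map_comp; congr rev; apply: eq_map => s /=.
exact: sumn_rev.
Qed.

Lemma sumn0_nil s : 0 \notin s -> sumn s = 0 -> s = [::].
Proof. by case: s => // x s; rewrite inE negb_or /= => /andP[]; lia. Qed.

(** Peeling off the first part of [a]: its value lies in the set of [b], which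
    is to say that some initial block of [b] has that sum. *)
Lemma refinesP b a : 0 \notin a -> 0 \notin b -> sumn a = sumn b ->
  refines b a <-> {subset comp_set a <= comp_set b}.
Proof.
elim: a b => [|x a IHa] b.
  move=> _ b0 /= /esym /(sumn0_nil b0) ->.
  by split=> // _; exists [::].
rewrite inE negb_or => /andP[x0 a0] b0 /= sab.
have [a_nil|[y [a' Ea]]] : a = [::] \/ exists y a', a = y :: a'.
  by case: (a) => [|y a']; [left|right; exists y, a'].
  move: sab; rewrite a_nil /= addn0 => xE; split=> // _.
  by exists [:: b]; rewrite /= cats0 xE.
split.
- move=> [[|b1 bb] [//= Eb [Ex Ebb]]] k.
  have b1b : 0 \notin b1 /\ 0 \notin flatten bb.
    by move: b0; rewrite -Eb mem_cat negb_or => /andP.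
  have sb : sumn a = sumn (flatten bb) by move: sab; rewrite -Eb sumn_cat; lia.
  have /(IHa _ a0 b1b.2 sb) sub : refines (flatten bb) a by exists bb.
  have b1n : 0 < size b1 by case: (b1) Ex => //=; lia.
  have bbn : 0 < size (flatten bb).
    move: sb a0; rewrite Ea /= inE; case: (flatten bb) => //=; lia.
  rewrite Ea comp_set_cons2 inE => /predU1P[->|/mapP[j jin ->]].
    apply/mem_comp_set; exists (size b1).
    by rewrite -Eb take_size_cat // size_cat; split=> //; lia.
  rewrite -Ea in jin; have /mem_comp_set[i [i0 ilt ->]] := sub _ jin.
  apply/mem_comp_set; exists (size b1 + i); rewrite -Eb size_cat.
  split; [lia|lia|]; rewrite take_cat ltnNge leq_addr /= addKn.
  by rewrite sumn_cat Ex.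
- move=> sub.
  have /mem_comp_set[i [i0 ilt xE]] : x \in comp_set b.
    by apply: sub; rewrite Ea comp_set_cons2 mem_head.
  have b0' := b0; rewrite -(cat_take_drop i b) mem_cat negb_or in b0'.
  case/andP: b0' => bt0 bd0.
  have sE : sumn b = x + sumn (drop i b).
    by rewrite -{1}(cat_take_drop i b) sumn_cat xE.
  have [bb [Eb Ebb]] : refines (drop i b) a; last first.
    exists (take i b :: bb); split=> /=; first by rewrite Eb cat_take_drop.
    by rewrite -xE Ebb.
  apply/IHa => //; first lia.
  move=> k ka.
  have k0 := comp_set_gt0 a0 ka.
  have /sub/mem_comp_set[j [j0 jlt kE]] : x + k \in comp_set (x :: a).
    by rewrite Ea comp_set_cons2 -Ea inE (map_f (addn x)) ?orbT.
  have ij : i < j.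
    rewrite ltnNge; apply/negP => ji; move: xE.
    rewrite -(subnKC ji) takeD sumn_cat -kE; lia.
  apply/mem_comp_set; exists (j - i); rewrite size_drop; split; [lia|lia|].
  have jE : take j b = take i b ++ take (j - i) (drop i b).
    by rewrite -takeD subnKC // ltnW.
  by move: kE; rewrite jE sumn_cat -xE => /addnI.
Qed.

(** The word 1...1 2...2 3...3 ... of content [b], for [o = 1]; the offset [o]
    makes the recursion structural. *)
Fixpoint labels_from (o : nat) (b : seq nat) : seq nat :=
  if b is x :: b' then nseq x o ++ labels_from o.+1 b' else [::].

Definition labels := labels_from 1.

Lemma size_labels b : size (labels b) = sumn b.
Proof.
rewrite /labels; elim: b 1 => [//|x b IHb] o /=.
by rewrite size_cat size_nseq IHb.
Qed.

Lemma labels_from_ge o b : all (leq o) (labels_from o b).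
Proof.
elim: b o => [//|x b IHb] o /=; rewrite all_cat; apply/andP; split.
  by apply/allP => y /nseqP[-> _].
by apply: sub_all (IHb o.+1) => y /ltnW.
Qed.

Lemma sorted_labels b : sorted leq (labels b).
Proof.
rewrite /labels; elim: b 1 => [//|x b IHb] o /=.
rewrite sorted_pairwise; last exact: leq_trans.
rewrite pairwise_cat -!sorted_pairwise; try exact: leq_trans.
rewrite IHb andbT; apply/andP; split.
  apply/allrelP => y z /nseqP[-> _] /(allP (labels_from_ge _ _)); exact: ltnW.
by case: x => //= x; apply: (sub_path (e := fun x y => x == y)) => [? ? /eqP->//|];
  elim: x => //= x ->; rewrite eqxx.
Qed.

Lemma count_labels b k : count_mem k.+1 (labels b) = nth 0 b k.
Proof.
suff H o : count_mem (o + k) (labels_from o b) = nth 0 b k by exact: (H 1).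
elim: b k o => [|x b IHb] k o /=; first by rewrite nth_nil.
rewrite count_cat count_nseq /= ; case: k => [|k] /=.
  rewrite addn0 eqxx mul1n (count_memPn _) ?addn0 //.
  by apply/negP => /(allP (labels_from_ge _ _)); rewrite ltnn.
by rewrite addnS -addSn IHb; case: eqP => //; lia.
Qed.

Lemma labels_gt0 b : 0 \notin labels b.
Proof. by apply/negP => /(allP (labels_from_ge _ _)). Qed.

(** This turns membership in Set(b) into a condition on two consecutive
    letters, the form in which sortedness of a word can be tested. *)
Lemma mem_comp_setE b k : 0 \notin b -> k.+1 < sumn b ->
  (k.+1 \in comp_set b) = (nth 0 (labels b) k != nth 0 (labels b) k.+1).
Proof.
rewrite /labels; elim: b k 1 => [//|x b IHb] k o.
rewrite inE negb_or => /andP[x0 b0] /= lt_k.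
rewrite !nth_cat !size_nseq !nth_nseq.
have cE : (k.+1 \in comp_set (x :: b)) = [&& 0 < size b, x <= k.+1 &
    (k.+1 == x) || (k.+1 - x \in comp_set b)].
  case: b b0 {IHb lt_k} => [|y b] b0; first by rewrite /comp_set.
  rewrite comp_set_cons2 inE /=; apply/idP/idP.
    case/predU1P => [->|/mapP[j jb ->]]; first by rewrite leqnn eqxx.
    by rewrite leq_addr addKn jb orbT.
  case/andP => xk /orP[->//|kin]; apply/orP; right.
  by apply/mapP; exists (k.+1 - x) => //; lia.
have bn : x <= k.+1 -> 0 < size b by case: (b) lt_k => //=; lia.
rewrite cE; case: (ltngtP k.+1 x) => [lt|gt|eqk] /=.
- by rewrite eqxx andbF.
- rewrite bn ?(ltnW gt) //=; have -> : k.+1 - x = (k - x).+1 by lia.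
  by rewrite (IHb _ o.+1) //; lia.
- rewrite bn ?eqk //= subnn; apply/esym.
  have : nth 0 (labels_from o.+1 b) 0 \in labels_from o.+1 b.
    apply: mem_nth; have := bn; rewrite eqk leqnn => /(_ isT).
    case: (b) b0 => // y b' /=; rewrite inE size_cat size_nseq; lia.
  by move/(allP (labels_from_ge _ _)) => h; apply/eqP; lia.
Qed.

(** * Words and tableaux *)

(** Both kinds of tableaux fit this pattern: [r] is the relation along the
    rows, [c] the relation along the first column, and [g] is any arrangement
    of the entries. *)
Definition is_tableau (r c : rel nat) (a g : seq nat)
    (T : seq (seq nat)) : bool :=
  [&& shape T == a, perm_eq (flatten T) g, all (sorted r) T
    & sorted c (first_column T)].

(** Reading the words [g] and [w] in parallel, the letter of [g] is entered in
    the row named by the letter of [w].  Rows are numbered from 0. *)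
Definition word_tableau (l : nat) (g w : seq nat) : seq (seq nat) :=
  [seq mask [seq j == i | j <- w] g | i <- iota 0 l].

(** The standard immaculate tableaux of shape [a], encoded by the sequence of
    the rows of the entries 1, 2, ...; comparing first occurrences amounts to
    comparing the entries of the first column. *)
Definition immaculate_word (a w : seq nat) : bool :=
  ([seq count_mem i w | i <- iota 0 (size a)] == a)
  && sorted ltn [seq index i w | i <- iota 0 (size a)].

(** The order in which the cells (entry, row) of a tableau must be read for the
    word of rows to determine it.  Between cells of different rows it has to
    agree with [c] from the lower to the upper row: this is what makes the
    first column [c]-sorted exactly when the letters first occur in order.  For
    [r] = [leq] and [c] = [ltn], equal entries are read from top to bottom; for
    [r] = [gtn] and [c] = [geq], entries decrease and equal entries are read
    from bottom to top. *)
Definition reading_rel (r c : rel nat) : rel (nat * nat) := fun p q =>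
  if p.2 == q.2 then r p.1 q.1
  else if p.2 < q.2 then c p.1 q.1 else ~~ c q.1 p.1.

(** [R] orders the labels compatibly with the reading order, so that the labels
    of a sorted biword are sorted and therefore determined by the content. *)
Record reading_order (r c R : rel nat) : Prop := ReadingOrder {
  row_trans : transitive r;
  row_anti : antisymmetric r;
  row_total : forall x y, x != y -> r x y || r y x;
  row_refl : reflexive r \/ irreflexive r;
  read_trans : transitive (reading_rel r c);
  letter_trans : transitive R;
  letter_anti : antisymmetric R;
  read_letter : forall p q, reading_rel r c p q -> R p.1 q.1
}.

Lemma mask_zip (g w : seq nat) i : size w = size g ->
  mask [seq j == i | j <- w] g = [seq p.1 | p <- zip g w & p.2 == i].
Proof.
elim: w g => [|y w IHw] [|x g] //= [/IHw ->].
by case: eqP.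
Qed.

Lemma count_mask (g w : seq nat) x i : size w = size g ->
  count_mem x (mask [seq j == i | j <- w] g) = count_mem (x, i) (zip g w).
Proof.
move=> sz; rewrite mask_zip // count_map count_filter.
by apply: eq_count => -[y j] /=; rewrite xpair_eqE.
Qed.

Lemma nth_tableau l g w i : i < l ->
  nth [::] (word_tableau l g w) i = mask [seq j == i | j <- w] g.
Proof. by move=> il; rewrite (nth_map 0) ?size_iota // nth_iota. Qed.

Lemma shape_tableau l g w : size w = size g ->
  shape (word_tableau l g w) = [seq count_mem i w | i <- iota 0 l].
Proof.
move=> sz; rewrite /shape -map_comp; apply: eq_map => i /=.
rewrite size_mask ?size_map // count_map; exact: eq_count.
Qed.

Lemma perm_flatten_tableau l g w : size w = size g -> all (gtn l) w ->
  perm_eq (flatten (word_tableau l g w)) g.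
Proof.
move=> sz wl; apply/permP => a; rewrite count_flatten sumnE big_map big_map.
elim: w g sz wl => [|y w IHw] [|x g] //=; first by rewrite big1.
move=> [sz] /andP[yl wl].
transitivity (\sum_(i <- iota 0 l)
    (a x * (y == i) + count a (mask [seq j == i | j <- w] g))).
  by apply: eq_bigr => i _; case: (y == i); rewrite ?muln1 ?muln0.
rewrite big_split /= IHw //; congr (_ + _).
rewrite -big_distrr /= -[RHS]muln1; congr (_ * _).
rewrite big_mkcond /= -big_mkcond sum1_count.
have -> : count (eq_op y) (iota 0 l) = count_mem y (iota 0 l).
  by apply: eq_count => j /=; rewrite eq_sym.
by rewrite count_uniq_mem ?iota_uniq // mem_iota yl.
Qed.

Lemma head_mask_index (g w : seq nat) i : size w = size g -> i \in w ->
  head 0 (mask [seq j == i | j <- w] g) = nth 0 g (index i w).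
Proof.
elim: w g => [|y w IHw] [|x g] //= [sz].
by rewrite inE eq_sym; case: eqP => //= _; exact: IHw.
Qed.

Lemma sorted_tableau r c R l g w : reading_order r c R -> size w = size g ->
  sorted (reading_rel r c) (zip g w) -> all (sorted r) (word_tableau l g w).
Proof.
move=> rc sz srt; apply/allP => _ /mapP[i _ ->].
rewrite mask_zip // sorted_map.
apply: (sub_in_sorted (P := fun p => p.2 == i) (e := reading_rel r c)).
- by move=> [x j] [y k] /eqP/= -> /eqP/= ->; rewrite /reading_rel /= eqxx.
- by apply/allP => p; rewrite mem_filter => /andP[].
- by apply: sorted_filter => //; exact: read_trans rc.
Qed.

(** The position of the first letter [i] is that of the first cell of row [i],
    and the reading order of two cells in distinct rows is [c] by definition. *)
Lemma reading_order_index r c R g w i j : reading_order r c R ->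
  size w = size g -> sorted (reading_rel r c) (zip g w) ->
  i \in w -> j \in w -> i < j ->
  c (nth 0 g (index i w)) (nth 0 g (index j w)) = (index i w < index j w).
Proof.
move=> rc sz srt iw jw ltij.
have read p q : p < q -> q < size w ->
    reading_rel r c (nth 0 g p, nth 0 w p) (nth 0 g q, nth 0 w q).
  move=> ltpq ltq; rewrite -!nth_zip //.
  apply: (sorted_ltn_nth (read_trans rc)) => //; rewrite inE size_zip -sz minnn //.
  exact: ltn_trans ltq.
case: (ltngtP (index i w) (index j w)) => [lt|lt|eq].
- have := read _ _ lt; rewrite index_mem => /(_ jw).
  by rewrite /reading_rel /= !nth_index // ltij ltn_eqF.
- have := read _ _ lt; rewrite index_mem => /(_ iw).
  rewrite /reading_rel /= !nth_index // gtn_eqF // ltnNge (ltnW ltij) /=.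
  exact: negbTE.
- by move: ltij; rewrite -(nth_index 0 iw) eq nth_index // ltnn.
Qed.

Lemma first_column_tableau r c R l g w : reading_order r c R ->
  size w = size g -> sorted (reading_rel r c) (zip g w) ->
  {subset iota 0 l <= w} ->
  sorted c (first_column (word_tableau l g w)) =
  sorted ltn [seq index i w | i <- iota 0 l].
Proof.
move=> rc sz srt lw.
have -> : first_column (word_tableau l g w) =
    [seq nth 0 g (index i w) | i <- iota 0 l].
  rewrite /first_column -map_comp; apply/eq_in_map => i il /=.
  by rewrite head_mask_index // lw.
rewrite !sorted_map.
have E i : i.+1 < l -> c (nth 0 g (index i w)) (nth 0 g (index i.+1 w))
    = (index i w < index i.+1 w).
  move=> il; apply: (reading_order_index rc) => //; apply: lw.
    by rewrite mem_iota /= add0n ltnW.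
  by rewrite mem_iota.
by apply/(sortedP 0)/(sortedP 0) => H i; rewrite size_iota => il;
  have := H i; rewrite size_iota !nth_iota ?(ltnW il) //= !add0n E //; exact.
Qed.

(** The tableau determines how often each pair (entry, row) occurs, and sorting
    the pairs recovers the biword. *)
Lemma word_tableau_inj r c R l g w1 w2 : reading_order r c R ->
  size w1 = size g -> size w2 = size g -> all (gtn l) w1 -> all (gtn l) w2 ->
  sorted (reading_rel r c) (zip g w1) -> sorted (reading_rel r c) (zip g w2) ->
  word_tableau l g w1 = word_tableau l g w2 -> w1 = w2.
Proof.
move=> rc s1 s2 l1 l2 srt1 srt2 E.
suff: zip g w1 = zip g w2.
  by move/(congr1 (@unzip2 _ _)); rewrite !unzip2_zip ?s1 ?s2.
apply: (sorted_eq (read_trans rc)) srt1 srt2 _.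
  move=> p q /andP[pq qp].
  have E1 : p.1 = q.1.
    by apply: (letter_anti rc); rewrite !(read_letter rc).
  have E2 : p.2 = q.2.
    move: pq qp; rewrite /reading_rel eq_sym E1.
    by case: ltngtP => // _; case: (c _ _).
  by move: E1 E2; case: (p) (q) => [? ?] [? ?] /= -> ->.
have wl w x i : size w = size g -> all (gtn l) w -> l <= i ->
    count_mem (x, i) (zip g w) = 0.
  move=> sw wl il; apply/count_memPn/negP => /(map_f snd) /=.
  rewrite -/(unzip2 _) unzip2_zip ?sw // => /(allP wl) /=; lia.
apply/allP => -[x i] _; apply/eqP; have [il|il] := ltnP i l; last by rewrite !wl.
by rewrite -!count_mask // -!(@nth_tableau l) // E.
Qed.

(** The word is found by sorting all the pairs (entry, row) of [T] in reading
    order. *)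
Lemma word_tableau_surj r c R g T : reading_order r c R ->
  sorted R g -> all (sorted r) T -> perm_eq (flatten T) g ->
  exists w, [/\ size w = size g, all (gtn (size T)) w,
    sorted (reading_rel r c) (zip g w) & word_tableau (size T) g w = T].
Proof.
move=> rc Rg rT Tg; pose z := reading_rel r c.
pose L := [seq (x, i) | i <- iota 0 (size T), x <- nth [::] T i].
have L1 : unzip1 L = flatten T.
  rewrite /unzip1 map_flatten -map_comp -[in RHS](mkseq_nth [::] T) /mkseq.
  by congr flatten; apply: eq_map => i /=; rewrite -map_comp map_id.
have Lcount x i : i < size T -> count_mem (x, i) L = count_mem x (nth [::] T i).
  move=> il; rewrite count_flatten sumnE big_map big_map.
  rewrite (bigD1_seq i) ?iota_uniq ?mem_iota //= big1 => [|j ji].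
    rewrite addn0 count_map; apply: eq_count => y /=.
    by rewrite xpair_eqE eqxx andbT.
  rewrite count_map; apply/eqP; rewrite -leqn0 leqNgt -has_count -all_predC.
  by apply/allP => y _ /=; rewrite xpair_eqE negb_and ji orbT.
have Ll p : p \in L -> p.2 < size T.
  by case/allpairsPdep => i [x [il _ ->]]; rewrite mem_iota in il.
pose Z := sort (fun p q => z p q || (p == q)) L.
have ZL : perm_eq Z L by rewrite perm_sort.
have Z_sorted : sorted z Z.
  have : sorted (fun p q => z p q || (p == q)) Z.
    apply: sort_sorted => -[x i] [y j]; rewrite /z /reading_rel /= !xpair_eqE.
    case: (ltngtP i j) => _ /=; rewrite ?andbF ?andbT ?orbF; try by case: (c _ _).
    case: (eqVneq x y) => [->|/(row_total rc)]; first by rewrite ?eqxx ?orbT.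
    by rewrite ?orbF.
  (* The sort uses the reflexive closure of the reading relation.  If rows are
     strict, no pair occurs twice, so consecutive pairs are related strictly. *)
  case: (row_refl rc) => [refl|irr].
    apply: sub_sorted => p q /orP[//|/eqP->].
    by rewrite /z /reading_rel eqxx.
  move=> /(sortedP (0, 0)) srt; apply/(sortedP (0, 0)) => k kZ.
  have /orP[//|] := srt k kZ; rewrite nth_uniq ?(ltnW kZ) //; first by lia.
  rewrite (perm_uniq ZL); apply: count_mem_uniq => -[x i].
  have [xiL|/count_memPn->//] := boolP (_ \in _).
  have il := Ll _ xiL; rewrite Lcount // count_uniq_mem.
    by move: xiL; rewrite -has_pred1 has_count Lcount // -has_count has_pred1 => ->.
  apply: (sorted_uniq (row_trans rc) irr).
  by apply: (allP rT); exact: mem_nth.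
have Zg : unzip1 Z = g.
  apply: (sorted_eq (letter_trans rc) (letter_anti rc)) => //.
    by rewrite sorted_map; apply: sub_sorted Z_sorted => p q /(read_letter rc).
  by apply: perm_trans (perm_map _ ZL) _; rewrite -/(unzip1 _) L1.
have Z2 : size (unzip2 Z) = size g by rewrite -Zg !size_map.
have zipZ : zip g (unzip2 Z) = Z by rewrite -Zg zip_unzip.
exists (unzip2 Z); split; rewrite ?zipZ //.
  by apply/allP => _ /mapP[p + ->]; rewrite (perm_mem ZL) => /Ll.
apply: (@eq_from_nth _ [::]); first by rewrite size_map size_iota.
move=> i; rewrite size_map size_iota => il; rewrite nth_tableau //.
apply: (sorted_eq (row_trans rc) (row_anti rc)).
- have := sorted_tableau (size T) rc Z2; rewrite zipZ => /(_ Z_sorted)/allP.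
  by apply; apply/mapP; exists i => //; rewrite mem_iota.
- by apply: (allP rT); exact: mem_nth.
- apply/allP => x _; apply/eqP.
  by rewrite count_mask // zipZ (permP ZL) Lcount.
Qed.

Lemma card_fset_set_injective_image (X : finType) (Y : choiceType)
    (f : X -> Y) (P : pred X) :
  {in P &, injective f} ->
  #|` fset_set [set y | exists2 x, P x & f x = y]|%fset = #|P|.
Proof.
move=> f_inj.
have -> : [set y | exists2 x, P x & f x = y]%classic =
    [set` [fset f x | x in P]%fset]%classic.
  apply/seteqP; split=> y /=.
    by move=> [x Px <-]; apply/imfsetP; exists x.
  by move=> /imfsetP[x /= Px ->]; exists x.
by rewrite set_fsetK card_in_imfset //= -cardE.
Qed.

(** The bijection between words and tableaux.  The involution [h] allows the
    tableaux to be listed upside down. *)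
Lemma card_is_tableau r c R n a g h : reading_order r c R ->
  sorted R g -> size g = n -> 0 \notin a -> involutive h ->
  #|` fset_set [set T | is_tableau r c a g (h T)]|%fset
  = #|[pred w : n.-tuple 'I_(size a) | immaculate_word a (map val w)
                     & sorted (reading_rel r c) (zip g (map val w))]|.
Proof.
move=> rc Rg gn a0 hK.
pose P (w : n.-tuple 'I_(size a)) :=
  immaculate_word a (map val w) && sorted (reading_rel r c) (zip g (map val w)).
transitivity #|P|; last exact: eq_card.
pose f (w : n.-tuple 'I_(size a)) := word_tableau (size a) g (map val w).
have sz (w : n.-tuple 'I_(size a)) : size (map val w) = size g.
  by rewrite size_map size_tuple.
have wl (w : n.-tuple 'I_(size a)) : all (gtn (size a)) (map val w).
  by apply/allP => _ /mapP[i _ ->] /=.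
have wordP (w : n.-tuple 'I_(size a)) :
    sorted (reading_rel r c) (zip g (map val w)) ->
    immaculate_word a (map val w) = is_tableau r c a g (f w).
  move=> srt; rewrite /immaculate_word /is_tableau shape_tableau //.
  rewrite perm_flatten_tableau //.
  rewrite (sorted_tableau _ rc) //=; case: eqP => //= cE.
  rewrite (first_column_tableau rc) // => i.
  rewrite mem_iota /= add0n => il; rewrite -has_pred1 has_count.
  have -> : count_mem i (map val w) = nth 0 a i.
    by rewrite -[in RHS]cE (nth_map 0) ?size_iota // nth_iota.
  by rewrite lt0n; apply: contraNneq a0 => <-; exact: mem_nth.
rewrite -(@card_fset_set_injective_image _ _ (h \o f)); last first.
  move=> w1 w2 /andP[_ srt1] /andP[_ srt2] /(inv_inj hK)/(word_tableau_inj rc) E.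
  by apply/val_inj/(inj_map val_inj)/E.
congr (#|` fset_set _|%fset); apply/seteqP; split=> T /=.
  move=> isT; have /and4P[/eqP sT pT rT _] := isT.
  have lT : size (h T) = size a by rewrite -sT size_map.
  have [w [sw lw srt]] := word_tableau_surj rc Rg rT pT; rewrite lT => wT.
  (* [w] as a tuple of ordinals: [pmap insub] restores the bounds on letters. *)
  have wE : w = map val (pmap insub w : seq 'I_(size a)).
    rewrite pmap_filter => [|i]; last by rewrite /= insubK.
    rewrite -[LHS]filter_predT; apply/eq_in_filter => i iw.
    by rewrite /= isSome_insub -lT; apply/esym/(allP lw).
  have szw : size (pmap insub w : seq 'I_(size a)) == n.
    by rewrite -gn -sw {2}wE size_map.
  exists (Tuple szw); last by rewrite /f /= -wE wT hK.
  by rewrite /P /= -wE srt andbT wE (@wordP (Tuple szw)) /f /= -wE // wT.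
by move=> [w /andP[wa srt] <-]; rewrite /= hK -wordP.
Qed.

(** * Semi-standard and row-strict tableaux; the action of omega *)

Lemma reading_order_ss : reading_order leq ltn leq.
Proof.
split.
- exact: leq_trans.
- exact: anti_leq.
- by move=> x y _; exact: leq_total.
- by left; exact: leqnn.
- move=> [y j] [x i] [z k]; rewrite /reading_rel /=.
  by case: (ltngtP i j) (ltngtP j k) (ltngtP i k) => ? [] ? [] ?; lia.
- exact: leq_trans.
- exact: anti_leq.
- by move=> [x i] [y j]; rewrite /reading_rel /=; case: (ltngtP i j) => _; lia.
Qed.

Lemma gtn_trans : transitive gtn.
Proof. by move=> y x z /= h1 h2; exact: ltn_trans h1. Qed.

Lemma reading_order_rs : reading_order gtn geq geq.
Proof.
split.
- exact: gtn_trans.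
- by move=> x y /=; lia.
- by move=> x y /=; rewrite neq_ltn orbC.
- by right => x; exact: ltnn.
- move=> [y j] [x i] [z k]; rewrite /reading_rel /=.
  by case: (ltngtP i j) (ltngtP j k) (ltngtP i k) => ? [] ? [] ?; lia.
- by move=> y x z /= h1 h2; exact: leq_trans h1.
- by move=> x y /=; lia.
- by move=> [x i] [y j]; rewrite /reading_rel /=; case: (ltngtP i j) => _; lia.
Qed.

Lemma perm_labels s b : 
  perm_eq s (labels b) <-> 0 \notin s /\ forall i, count_mem i.+1 s = nth 0 b i.
Proof.
split=> [sb|[s0 sb]].
  split=> [|i]; first by rewrite (perm_mem sb) labels_gt0.
  by rewrite (permP sb) count_labels.
apply/allP => -[|i] _ /=; last by rewrite sb count_labels.
by rewrite !(count_memPn _) ?labels_gt0.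
Qed.

Lemma ss_immaculate_is_tableau a b T :
  ss_immaculate a T /\ has_content T b <-> is_tableau leq ltn a (labels b) T.
Proof.
split=> [[[[sT T0] cT rT] Tb]|/and4P[/eqP sT pT rT cT]].
  by apply/and4P; split=> //; [exact/eqP|exact/perm_labels].
by have [T0 Tb] := (perm_labels _ _).1 pT.
Qed.

(** Turning the rows upside down makes the first column weakly decreasing and
    the shape [a]; listing the labels in decreasing order then matches the
    strictly decreasing rows. *)
Lemma rs_reverse_immaculate_is_tableau a b T :
  rs_reverse_immaculate (rev a) T /\ has_content T b
  <-> is_tableau gtn geq a (rev (labels b)) (rev T).
Proof.
have cE : sorted geq (first_column (rev T)) = sorted leq (first_column T).
  by rewrite /first_column map_rev rev_sorted.
have pE : perm_eq (flatten (rev T)) (rev (labels b)) =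
    perm_eq (flatten T) (labels b).
  have /permPl -> : perm_eq (flatten (rev T)) (flatten T).
    by apply: perm_flatten; rewrite perm_rev.
  by rewrite perm_sym perm_rev perm_sym.
rewrite /is_tableau cE pE all_rev /shape map_rev.
split=> [[[[sT T0] cT rT] Tb]|/and4P[/eqP sT pT rT cT]].
  by apply/and4P; split=> //; [rewrite -/(shape T) sT revK|exact/perm_labels].
by have [T0 Tb] := (perm_labels _ _).1 pT; split=> //; split=> //; rewrite -sT revK.
Qed.

(** Equal labels are read with weakly decreasing rows, so the row may increase
    only where the label changes. *)
Lemma sorted_zip_labels b w : 0 \notin b -> size w = sumn b ->
  sorted (reading_rel leq ltn) (zip (labels b) w) <->
  (forall k, k.+1 < sumn b -> nth 0 w k < nth 0 w k.+1 -> k.+1 \in comp_set b).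
Proof.
move=> b0 sw.
have step k : k.+1 < sumn b -> reading_rel leq ltn
    (nth (0, 0) (zip (labels b) w) k) (nth (0, 0) (zip (labels b) w) k.+1)
    = (nth 0 w k < nth 0 w k.+1) ==> (k.+1 \in comp_set b).
  move=> kb; rewrite !nth_zip ?size_labels // /reading_rel /= mem_comp_setE //.
  have := sortedP 0 (sorted_labels b) k; rewrite size_labels => /(_ kb).
  by case: (ltngtP (nth 0 w k) (nth 0 w k.+1)); lia.
split=> [/(sortedP (0, 0)) srt k kb|H].
  by apply/implyP; rewrite -step // srt // size_zip size_labels sw minnn.
apply/(sortedP (0, 0)) => k; rewrite size_zip size_labels sw minnn => kb.
by rewrite step //; apply/implyP/H.
Qed.

(** Equal labels are now read with strictly increasing rows, so the label must
    change at every non-ascent; reversing the labels turns the position [k.+1]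
    into [sumn b - k.+1]. *)
Lemma sorted_zip_rev_labels b w : 0 \notin b -> size w = sumn b ->
  sorted (reading_rel gtn geq) (zip (rev (labels b)) w) <->
  (forall k, k.+1 < sumn b -> ~~ (nth 0 w k < nth 0 w k.+1) ->
     sumn b - k.+1 \in comp_set b).
Proof.
move=> b0 sw.
have step k : k.+1 < sumn b -> reading_rel gtn geq
    (nth (0, 0) (zip (rev (labels b)) w) k) (nth (0, 0) (zip (rev (labels b)) w) k.+1)
    = ~~ (nth 0 w k < nth 0 w k.+1) ==> (sumn b - k.+1 \in comp_set b).
  move=> kb; rewrite !nth_zip ?size_rev ?size_labels // /reading_rel /=.
  rewrite !nth_rev ?size_labels //; last exact: ltnW.
  have E : sumn b - k.+1 = (sumn b - k.+2).+1 by lia.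
  rewrite E mem_comp_setE //; last by lia.
  have := sortedP 0 (sorted_labels b) (sumn b - k.+2); rewrite size_labels -E.
  by case: (ltngtP (nth 0 w k) (nth 0 w k.+1)); lia.
split=> [/(sortedP (0, 0)) srt k kb|H].
  by apply/implyP; rewrite -step // srt // size_zip size_rev size_labels sw minnn.
apply/(sortedP (0, 0)) => k; rewrite size_zip size_rev size_labels sw minnn => kb.
by rewrite step //; apply/implyP/H.
Qed.

Lemma comp_notin0 n (a : composition n) : 0 \notin parts a.
Proof. by case: a => s /= /andP[]. Qed.

Lemma comp_sumn n (a : composition n) : sumn (parts a) = n.
Proof. by case: a => s /= /andP[_ /eqP]. Qed.

Lemma comp_refinesP n (b a : composition n) :
  refines b a <-> {subset comp_set a <= comp_set b}.
Proof. by apply: refinesP; rewrite ?comp_notin0 ?comp_sumn. Qed.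

(** The composition whose set is the ascent set of the word, that is, the
    descent composition of the standard immaculate tableau it encodes. *)
Definition word_comp n (w : seq nat) : composition n :=
  set_comp n [pred k | nth 0 w k.-1 < nth 0 w k].

Lemma refines_word_comp n (b : composition n) w : size w = n ->
  refines b (word_comp n w) <-> sorted (reading_rel leq ltn) (zip (labels b) w).
Proof.
move=> sw; apply: iff_trans (comp_refinesP _ _) _; apply: iff_sym.
apply: iff_trans (sorted_zip_labels _ _) _; rewrite ?comp_notin0 ?comp_sumn //.
split=> [H [|k]|H k kn]; rewrite ?mem_comp_set_comp //=.
  by move=> /andP[]; exact: H.
by move=> ltw; apply: H; rewrite mem_comp_set_comp /= kn.
Qed.

Lemma refines_comp_tr_word_comp n (b : composition n) w : size w = n ->
  refines b (comp_tr (word_comp n w)) <->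
  sorted (reading_rel gtn geq) (zip (rev (labels b)) w).
Proof.
move=> sw; apply: (@iff_trans _ (refines (comp_rev b) (comp_compl (word_comp n w)))).
  by split=> /refines_rev; rewrite /= revK.
apply: iff_trans (comp_refinesP _ _) _; apply: iff_sym.
apply: iff_trans (sorted_zip_rev_labels _ _) _; rewrite ?comp_notin0 ?comp_sumn //.
have E k : k.+1 < n ->
    (k.+1 \in comp_set (comp_rev b)) = (n - k.+1 \in comp_set b).
  by move=> kn; rewrite mem_comp_set_rev comp_sumn.
split=> [H [|k]|H k kn]; rewrite ?mem_comp_set_comp //=.
  by case/andP => kn; rewrite inE mem_comp_set_comp /= kn E //; exact: H.
move=> ltw; rewrite -E //; apply: H.
by rewrite mem_comp_set_comp /= kn inE mem_comp_set_comp /= kn.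
Qed.

Definition reverse_K (a b : seq nat) : nat :=
  #|` fset_set [set T | rs_reverse_immaculate a T /\ has_content T b]|%fset.

Lemma K_words n (a b : composition n) :
  K a b = #|[pred w : n.-tuple 'I_(size a) | immaculate_word a (map val w)
                     & `[< refines b (word_comp n (map val w)) >]]|.
Proof.
rewrite /K; have -> : [set T | ss_immaculate a T /\ has_content T b]%classic
   = [set T | is_tableau leq ltn a (labels b) (id T)]%classic.
  by apply/seteqP; split=> T /=; rewrite ss_immaculate_is_tableau.
rewrite (card_is_tableau reading_order_ss (sorted_labels b) (n := n));
  rewrite ?size_labels ?comp_sumn ?comp_notin0 //.
apply: eq_card => w; rewrite !inE; congr (_ && _).
apply/idP/asboolP; rewrite refines_word_comp // size_map size_tuple //.
Qed.

Lemma reverse_K_words n (a b : composition n) :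
  reverse_K (comp_rev a) b
  = #|[pred w : n.-tuple 'I_(size a) | immaculate_word a (map val w)
         & `[< refines b (comp_tr (word_comp n (map val w))) >]]|.
Proof.
rewrite /reverse_K.
have -> : [set T | rs_reverse_immaculate (comp_rev a) T /\ has_content T b]%classic
   = [set T | is_tableau gtn geq a (rev (labels b)) (rev T)]%classic.
  by apply/seteqP; split=> T /=; rewrite rs_reverse_immaculate_is_tableau.
rewrite (card_is_tableau reading_order_rs (n := n));
  rewrite ?size_rev ?size_labels ?comp_sumn ?comp_notin0 //.
- apply: eq_card => w; rewrite !inE; congr (_ && _).
  apply/idP/asboolP; rewrite refines_comp_tr_word_comp // size_map size_tuple //.
- by rewrite rev_sorted sorted_labels.
- exact: revK.
Qed.

Lemma sum_QM_words n (I : finType) (P : pred I) (Q : composition n -> pred I) :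
  (\sum_b QM b *+ #|[pred w | P w & Q b w]| =
   \sum_(w | P w) \sum_(b | Q b w) QM b)%R.
Proof.
rewrite (exchange_big_dep predT) //=; apply: eq_bigr => b _.
by rewrite sumr_const.
Qed.

Lemma dual_immaculate_F n (a : composition n) :
  dual_immaculate a =
  (\sum_(w : n.-tuple 'I_(size a) | immaculate_word a (map val w))
     QF (word_comp n (map val w)))%R.
Proof.
rewrite /QF -sum_QM_words; apply: eq_bigr => b _; by rewrite K_words.
Qed.

(** The conditions imposed on words by the transposed compositions are those
    that describe row-strict reverse tableaux. *)
Lemma omega_dual_immaculate (omega : {additive qsym -> qsym})
    (omegaF : forall (n : nat) (a : composition n),
        omega (QF a) = QF (comp_tr a)) n (a : composition n) :
  omega (dual_immaculate a) =
  (\sum_(b : composition n) QM b *+ reverse_K (comp_rev a) b)%R.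
Proof.
rewrite dual_immaculate_F raddf_sum; under eq_bigr do rewrite omegaF.
by rewrite /QF -sum_QM_words; apply: eq_bigr => b _; rewrite reverse_K_words.
Qed.

(** * Dominance *)

Definition dominated (b a : seq nat) : Prop :=
  forall m, sumn (take m b) <= sumn (take m a).

Lemma dominated_refl a : dominated a a. Proof. by []. Qed.

Lemma dominated_trans c b a : dominated a c -> dominated c b -> dominated a b.
Proof. by move=> ac cb m; apply: leq_trans (ac m) (cb m). Qed.

Lemma sumn_takeS s m : sumn (take m.+1 s) = sumn (take m s) + nth 0 s m.
Proof.
have [ms|ms] := ltnP m (size s); first by rewrite (take_nth 0) // sumn_rcons.
by rewrite nth_default // addn0 !take_oversize // ltnW.
Qed.

Lemma eq_nth_pos a b : 0 \notin a -> 0 \notin b -> nth 0 a =1 nth 0 b -> a = b.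
Proof.
move=> a0 b0 E; apply: (@eq_from_nth _ 0) => [|i _]; last exact: E.
wlog le : a b a0 b0 E / size a <= size b.
  by move=> H; case: (leqP (size a) (size b)) => [|/ltnW] h;
    [|apply/esym]; apply: H => // i; rewrite E.
apply/eqP; rewrite eqn_leq le leqNgt; apply: contraNN b0 => lt.
by rewrite -(nth_default 0 (leqnn (size a))) E mem_nth.
Qed.

Lemma dominated_anti a b : 0 \notin a -> 0 \notin b ->
  dominated a b -> dominated b a -> a = b.
Proof.
move=> a0 b0 ab ba; apply: eq_nth_pos => // i.
have E m : sumn (take m a) = sumn (take m b) by apply/eqP; rewrite eqn_leq ab ba.
by have := E i.+1; rewrite !sumn_takeS E => /addnI.
Qed.

Lemma dominated_lexle b a : 0 \notin a -> 0 \notin b -> dominated b a -> lexle b a.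
Proof.
move=> a0 b0 ba.
have [ex|nex] := pselect (exists i, nth 0 b i != nth 0 a i); last first.
  left; apply: eq_nth_pos => // i.
  by apply/eqP; apply: contrapT => /negP ne; apply: nex; exists i.
right; case: (ex_minnP ex) => i ne min; exists i.
have E j : j < i -> nth 0 b j = nth 0 a j.
  by move=> ji; apply/eqP; apply: contraTT ji => /min; rewrite -leqNgt.
split=> //; rewrite ltn_neqAle ne /=.
have := ba i.+1; rewrite !sumn_takeS.
suff -> : sumn (take i b) = sumn (take i a) by rewrite leq_add2l.
elim: i E {ne min} => [|i IHi] E; first by rewrite !take0.
by rewrite !sumn_takeS IHi ?E // => j ji; apply: E; exact: ltnW.
Qed.

Lemma count_leqS s m : count (geq m.+1) s = count (geq m) s + count_mem m.+1 s.
Proof. by elim: s => //= x s ->; lia. Qed.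

Lemma sumn_take_content T b m : 0 \notin flatten T -> has_content T b ->
  sumn (take m b) = count (geq m) (flatten T).
Proof.
move=> T0 Tb; elim: m => [|m IHm].
  rewrite take0 -[LHS](count_memPn T0); apply: eq_count => x /=; lia.
by rewrite sumn_takeS IHm count_leqS Tb.
Qed.

Lemma count_flatten_nth (p : pred nat) T :
  count p (flatten T) = \sum_(i < size T) count p (nth [::] T i).
Proof. by rewrite count_flatten sumnE big_map (big_nth [::]) big_mkord. Qed.

Lemma row_notin0 (T : seq (seq nat)) i : 0 \notin flatten T -> 0 \notin nth [::] T i.
Proof.
move=> T0; have [iT|iT] := ltnP i (size T); last by rewrite nth_default.
apply: contraNN T0 => h; apply/flattenP; exists (nth [::] T i) => //.
exact: mem_nth.
Qed.

(** The two halves of the extremality argument: a tableau [T0] whose rows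
    contain, for every [m], as many entries [<= m] as possible has the dominant
    content, and a tableau with the same content has the same rows. *)
Lemma row_dominance T T0 : size T = size T0 ->
  (forall i m, i < size T ->
     count (geq m) (nth [::] T i) <= count (geq m) (nth [::] T0 i)) ->
  forall m, count (geq m) (flatten T) <= count (geq m) (flatten T0).
Proof.
move=> sT le m; rewrite !count_flatten_nth -sT.
by apply: leq_sum => i _; exact: le.
Qed.

Lemma row_dominance_perm T T0 : size T = size T0 ->
  (forall i m, i < size T ->
     count (geq m) (nth [::] T i) <= count (geq m) (nth [::] T0 i)) ->
  0 \notin flatten T -> 0 \notin flatten T0 ->
  (forall m, count (geq m) (flatten T) = count (geq m) (flatten T0)) ->
  forall i, i < size T -> perm_eq (nth [::] T i) (nth [::] T0 i).
Proof.
move=> sT le Tpos T0pos E i iT.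
have {le}E m : count (geq m) (nth [::] T i) = count (geq m) (nth [::] T0 i).
  have := leqif_sum (fun (j : 'I_(size T)) (_ : true) => leqif_eq (le j m (ltn_ord j))).
  have sumT0 : \sum_(j < size T) count (geq m) (nth [::] T0 j)
      = count (geq m) (flatten T0) by rewrite count_flatten_nth sT.
  case=> _; rewrite -count_flatten_nth sumT0 E eqxx.
  by move/esym/forallP/(_ (Ordinal iT))/eqP.
apply/allP => -[|x] _ /=; last first.
  by apply/eqP; have := E x.+1; rewrite !count_leqS E => /addnI.
by rewrite !(count_memPn _) ?row_notin0.
Qed.

Lemma nth_first_column T i : nth 0 (first_column T) i = head 0 (nth [::] T i).
Proof.
have [iT|iT] := ltnP i (size T); first by rewrite (nth_map [::]).
by rewrite !nth_default ?size_map.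
Qed.

Lemma size_row a (T : seq (seq nat)) i : shape T = a ->
  size (nth [::] T i) = nth 0 a i.
Proof. by move=> <-; rewrite nth_shape. Qed.

(** * Semi-standard immaculate tableaux of extremal content *)

Definition row_constant (a : seq nat) : seq (seq nat) :=
  [seq nseq (nth 0 a i) i.+1 | i <- iota 0 (size a)].

Lemma nth_row_constant a i : i < size a ->
  nth [::] (row_constant a) i = nseq (nth 0 a i) i.+1.
Proof. by move=> ia; rewrite (nth_map 0) ?size_iota // nth_iota. Qed.

Lemma flatten_row_constant a : flatten (row_constant a) = labels a.
Proof.
suff H o : flatten [seq nseq (nth 0 a i) (o + i) | i <- iota 0 (size a)]
    = labels_from o a by exact: (H 1).
elim: a o => [//|x a IHa] o /=; rewrite addn0 -IHa (iotaDl 1 0) -map_comp.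
by congr (_ ++ flatten _); apply: eq_map => i /=; rewrite addnCA add1n addSn.
Qed.

Lemma row_constant_content a : 0 \notin flatten (row_constant a)
  /\ has_content (row_constant a) a.
Proof. by apply/perm_labels; rewrite flatten_row_constant. Qed.

Lemma row_constant_immaculate a : 0 \notin a -> ss_immaculate a (row_constant a).
Proof.
move=> a0; split.
- split; last by case: (row_constant_content a).
  rewrite /shape -map_comp -[RHS](mkseq_nth 0); apply: eq_map => i /=.
  by rewrite size_nseq.
- have -> : first_column (row_constant a) = iota 1 (size a).
    rewrite /first_column -map_comp (iotaDl 1 0); apply/eq_in_map => i.
    rewrite mem_iota /= add0n => ia.
    have : nth 0 a i != 0 by apply: contraNneq a0 => <-; exact: mem_nth.
    by case: (nth 0 a i).
  exact: iota_ltn_sorted.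
- apply/allP => _ /mapP[i _ ->]; apply/(sortedP 0) => j; rewrite size_nseq => jl.
  by rewrite !nth_nseq jl (ltnW jl).
Qed.

(** The first column starts at 1 at least and increases strictly. *)
Lemma ss_immaculate_row_ge a T i x : 0 \notin a -> ss_immaculate a T ->
  x \in nth [::] T i -> i < x.
Proof.
move=> a0 [[sT T0] cT rT].
have hd j : j < size T -> j < head 0 (nth [::] T j).
  elim: j => [|j IHj] jT.
    have : size (nth [::] T 0) != 0.
      rewrite (size_row _ sT); apply: contraNneq a0 => <-; apply: mem_nth.
      by rewrite -sT size_map.
    have := row_notin0 0 T0; case: (nth [::] T 0) => //= y r.
    by rewrite inE negb_or; lia.
  apply: leq_ltn_trans (IHj (ltnW jT)) _; rewrite -!nth_first_column.
  by apply: (sortedP 0 cT); rewrite size_map.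
have [iT|iT] := ltnP i (size T); last by rewrite nth_default.
have := hd i iT; have := allP rT _ (mem_nth [::] iT).
case: (nth [::] T i) => //= y r /(order_path_min leq_trans)/allP yr iy.
by rewrite inE => /predU1P[->//|/yr]; exact: leq_trans.
Qed.

Lemma ss_immaculate_row_count a T i m : 0 \notin a -> ss_immaculate a T ->
  i < size T ->
  count (geq m) (nth [::] T i) <= count (geq m) (nth [::] (row_constant a) i).
Proof.
move=> a0 Ta iT; have [[sT _] _ _] := Ta.
have ia : i < size a by rewrite -sT size_map.
rewrite nth_row_constant // count_nseq /=; have [im|im] := ltnP i m.
  by rewrite mul1n -(size_row _ sT) count_size.
rewrite leqNgt -has_count; apply/hasPn => x /(ss_immaculate_row_ge a0 Ta) /=.
lia.
Qed.

Lemma size_row_constant a : size (row_constant a) = size a.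
Proof. by rewrite size_map size_iota. Qed.

Lemma ss_immaculate_dominated a b T : 0 \notin a ->
  ss_immaculate a T -> has_content T b -> dominated b a.
Proof.
move=> a0 Ta Tb m; have [[sT T0] _ _] := Ta.
have [C0 Cb] := row_constant_content a.
rewrite (sumn_take_content m T0 Tb) (sumn_take_content m C0 Cb).
apply: row_dominance => [|i k iT]; first by rewrite size_row_constant -sT size_map.
exact: ss_immaculate_row_count.
Qed.

Lemma ss_immaculate_content_shape a T : 0 \notin a ->
  ss_immaculate a T -> has_content T a -> T = row_constant a.
Proof.
move=> a0 Ta Tb; have [[sT T0] _ rT] := Ta.
have [C0 Cb] := row_constant_content a.
have sz : size T = size (row_constant a) by rewrite size_row_constant -sT size_map.
apply: (@eq_from_nth _ [::]) => // i iT.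
apply: (sorted_eq leq_trans anti_leq).
- exact: allP rT _ (mem_nth _ iT).
- have [_ _ /allP] := row_constant_immaculate a0; apply.
  by apply: mem_nth; rewrite -sz.
- apply: row_dominance_perm => // [j m|m]; first exact: ss_immaculate_row_count.
  by rewrite -(sumn_take_content m T0 Tb) -(sumn_take_content m C0 Cb).
Qed.

Lemma K_dominated a b : 0 \notin a -> K a b != 0 -> dominated b a.
Proof.
move=> a0 Kab; apply: contrapT => nd; move/eqP: Kab; apply.
rewrite /K; suff -> : [set T | ss_immaculate a T /\ has_content T b]%classic = set0.
  by rewrite fset_set0 cardfs0.
apply/seteqP; split=> // T /= [Ta Tb].
by apply: nd; exact: ss_immaculate_dominated Ta Tb.
Qed.

Lemma K_diag a : 0 \notin a -> K a a = 1.
Proof.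
move=> a0; rewrite /K; suff -> : [set T | ss_immaculate a T /\ has_content T a]%classic
    = [set row_constant a]%classic by rewrite fset_set1 cardfs1.
apply/seteqP; split=> T /=; last first.
  move=> ->; split; first exact: row_constant_immaculate.
  by case: (row_constant_content a).
by move=> [Ta Tb]; exact: ss_immaculate_content_shape.
Qed.

(** * The extremal row-strict reverse immaculate tableau *)

Definition extremal_tableau (s : seq nat) : seq (seq nat) :=
  [seq running_max s i :: rev (iota 1 (nth 0 s i - 1)) | i <- iota 0 (size s)].

Lemma size_extremal s : size (extremal_tableau s) = size s.
Proof. by rewrite size_map size_iota. Qed.

Lemma nth_extremal s i : i < size s -> nth [::] (extremal_tableau s) i
  = running_max s i :: rev (iota 1 (nth 0 s i - 1)).
Proof. by move=> ia; rewrite (nth_map 0) ?size_iota // nth_iota. Qed.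

Lemma leq_running_max s i : nth 0 s i <= running_max s i.
Proof. exact: (leq_bigmax (@ord_max i)). Qed.

Lemma running_maxS s i : running_max s i <= running_max s i.+1.
Proof. by rewrite /running_max [X in _ <= X]big_ord_recr leq_maxl. Qed.

Lemma nth_gt0 s i : 0 \notin s -> i < size s -> 0 < nth 0 s i.
Proof. by move=> s0 ls; rewrite lt0n; apply: contraNneq s0 => <-; exact: mem_nth. Qed.

Lemma extremal_tableau_immaculate s : 0 \notin s ->
  rs_reverse_immaculate s (extremal_tableau s).
Proof.
move=> s0; split.
- split.
    apply: (@eq_from_nth _ 0); rewrite ?size_map ?size_iota // => i il.
    rewrite nth_shape nth_extremal //= size_rev size_iota.
    by have := nth_gt0 s0 il; lia.
  apply/flattenP => -[_ /mapP[i + ->]]; rewrite mem_iota add0n => il.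
  rewrite inE mem_rev mem_iota /= orbF => /eqP E.
  by have := nth_gt0 s0 il; have := leq_running_max s i; lia.
- apply/(sortedP 0) => i; rewrite size_map size_extremal => il.
  rewrite !nth_first_column !nth_extremal ?(ltnW il) //=; exact: running_maxS.
- apply/allP => _ /mapP[i + ->]; rewrite mem_iota add0n => il.
  rewrite /= path_sortedE; last exact: gtn_trans.
  rewrite rev_sorted iota_ltn_sorted andbT; apply/allP => x.
  by rewrite mem_rev mem_iota /=; have := leq_running_max s i; lia.
Qed.

(** [size t < x] because [x :: t] consists of distinct elements of 1, ..., x. *)
Lemma sorted_gtn_size x t : sorted gtn (x :: t) -> 0 \notin x :: t -> size t < x.
Proof.
move=> srt pos; have : uniq (x :: t).
  by apply: (sorted_uniq gtn_trans) => // y; exact: ltnn.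
move/uniq_leq_size => /(_ (iota 1 x)); rewrite size_iota; apply=> y.
have y0 : y \in x :: t -> 0 < y by move=> yin; rewrite lt0n; apply: contraNneq pos => <-.
move=> yin; rewrite mem_iota add1n ltnS y0 //=; move: yin.
rewrite inE => /predU1P[->//|]; have /= /(order_path_min gtn_trans)/allP h := srt.
by move/h => /ltnW.
Qed.

Lemma count_geq_iota m k : count (geq m) (iota 1 k) = minn m k.
Proof.
elim: k => [|k IHk]; first by rewrite minn0.
by rewrite -[k.+1]addn1 iotaD count_cat IHk /=; lia.
Qed.

Lemma sorted_gtn_count t m : sorted gtn t -> 0 \notin t ->
  count (geq m) t <= minn m (size t).
Proof.
move=> srt pos; rewrite leq_min count_size andbT.
have : uniq ([seq x <- t | geq m x]).
  by apply/filter_uniq/(sorted_uniq gtn_trans) => // y; exact: ltnn.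
move/uniq_leq_size => /(_ (iota 1 m)); rewrite size_iota size_filter; apply=> y.
rewrite mem_filter mem_iota add1n ltnS => /andP[/= -> yt]; rewrite andbT lt0n.
by apply: contraNneq pos => <-.
Qed.

(** The first entry of row [i] is at least that of each row [j <= i], which is
    at least the length of row [j], since that row decreases strictly down to a
    positive entry. *)
Lemma reverse_immaculate_head s T i : 0 \notin s -> rs_reverse_immaculate s T ->
  i < size T -> running_max s i <= head 0 (nth [::] T i).
Proof.
move=> s0 [[sT T0] cT rT] iT; apply/bigmax_leqP => j _.
have ji : j <= i by rewrite -ltnS.
have jT : j < size T by exact: leq_ltn_trans iT.
apply: (@leq_trans (head 0 (nth [::] T j))).
  have := allP rT _ (mem_nth [::] jT); have := row_notin0 j T0.
  rewrite -(size_row j sT); case: (nth [::] T j) => // x t pos srt.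
  exact: sorted_gtn_size.
rewrite -!nth_first_column; apply: (sorted_leq_nth leq_trans leqnn) => //;
  by rewrite inE size_map.
Qed.

Lemma reverse_immaculate_row_count s T i m : 0 \notin s ->
  rs_reverse_immaculate s T -> i < size T ->
  count (geq m) (nth [::] T i) <= count (geq m) (nth [::] (extremal_tableau s) i).
Proof.
move=> s0 Ts iT; have [[sT T0] cT rT] := Ts.
have is_ : i < size s by rewrite -sT size_map.
rewrite nth_extremal //= count_rev count_geq_iota.
have := reverse_immaculate_head s0 Ts iT; have := allP rT _ (mem_nth [::] iT).
have := row_notin0 i T0; have := nth_gt0 s0 is_; rewrite -(size_row i sT).
case: (nth [::] T i) => //= x t _; rewrite inE negb_or => /andP[_ t0] srt hx.
have := sorted_gtn_count m (path_sorted srt) t0; lia.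
Qed.

(** The two terms of [beta_omega] count the entries outside the first column
    and those in it; the former are counted in [a], the latter in [rev a], hence
    the reversal of indices. *)
Lemma extremal_tableau_content a : 0 \notin a ->
  has_content (extremal_tableau (rev a)) (beta_omega a).
Proof.
move=> a0 m; rewrite count_flatten_nth size_extremal size_rev.
have -> : \sum_(i < size a) count_mem m.+1 (nth [::] (extremal_tableau (rev a)) i)
  = \sum_(i < size a) (m < nth 0 a i - 1)
    + \sum_(i < size a) (running_max (rev a) i == m.+1).
  rewrite [X in _ = X + _](reindex_inj rev_ord_inj) -big_split /=.
  apply: eq_bigr => i _; rewrite nth_extremal ?size_rev //= nth_rev //.
  rewrite addnC count_rev count_uniq_mem ?iota_uniq // mem_iota.
  by congr (nat_of_bool _ + _); lia.
have card (p : pred 'I_(size a)) : #|p| = \sum_(i < size a) p i.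
  rewrite -sum1_card big_mkcond; apply: eq_bigr => i _.
  by rewrite unfold_in; case: (p i).
have [mM|mM] := ltnP m (\max_(x <- a) x).
  rewrite (nth_map 0) ?size_iota // nth_iota // add1n.
  by rewrite !card.
have le i : nth 0 a i <= \max_(x <- a) x.
  have [ia|ia] := ltnP i (size a); last by rewrite nth_default.
  by apply: leq_bigmax_seq => //; exact: mem_nth.
rewrite [RHS]nth_default ?size_map ?size_iota // !big1 // => i _.
  have : running_max (rev a) i <= \max_(x <- a) x.
    apply/bigmax_leqP => j _; rewrite nth_rev ?le //.
    exact: leq_trans (ltn_ord j) (ltn_ord i).
  by case: eqP => //; lia.
by have := le i; lia.
Qed.

(** A row of maximal length [M] contributes to the first term of each part
    with index below [M], and its running maximum is [M]. *)
Lemma beta_omega_gt0 a : 0 \notin beta_omega a.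
Proof.
apply/mapP => -[m]; rewrite mem_iota => /andP[m0]; rewrite add1n ltnS => mM.
have sa : 0 < size a by case: a mM => // ; rewrite big_nil; lia.
have [i Ei] : exists i : 'I_(size a), \max_(x <- a) x = nth 0 a i.
  rewrite (big_nth 0) big_mkord.
  have [|i ->] := @eq_bigmax 'I_(size a) (nth 0 a); last by exists i.
  by rewrite card_ord.
move=> /esym/eqP; rewrite addn_eq0 => /andP[/eqP/card0_eq/(_ i) E1].
move=> /eqP/card0_eq/(_ (rev_ord i)) E2; move: E1 E2; rewrite !inE -Ei => E1.
have Em : m = \max_(x <- a) x by lia.
suff -> : running_max (rev a) (rev_ord i) == m by [].
rewrite eqn_leq; apply/andP; split.
  apply/bigmax_leqP => j _; rewrite Em; apply: leq_bigmax_seq => //.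
  rewrite -mem_rev; apply: mem_nth; rewrite size_rev.
  exact: leq_trans (ltn_ord j) (ltn_ord (rev_ord i)).
apply: leq_trans (leq_running_max _ _); rewrite nth_rev ?(ltn_ord (rev_ord i)) //=.
by rewrite subnSK // subKn ?Em ?Ei // ltnW.
Qed.

Lemma sumn_beta_omega a : 0 \notin a -> sumn (beta_omega a) = sumn a.
Proof.
move=> a0; have s0 : 0 \notin rev a by rewrite mem_rev.
have [[sT T0] _ _] := extremal_tableau_immaculate s0.
have : perm_eq (flatten (extremal_tableau (rev a))) (labels (beta_omega a)).
  by apply/perm_labels; split=> //; exact: extremal_tableau_content.
by move/perm_size; rewrite size_labels size_flatten sT sumn_rev => ->.
Qed.

Lemma reverse_immaculate_dominated a b T : 0 \notin a ->
  rs_reverse_immaculate (rev a) T -> has_content T b -> dominated b (beta_omega a).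
Proof.
move=> a0 Ta Tb m; have s0 : 0 \notin rev a by rewrite mem_rev.
have [[sT T0] _ _] := Ta; have [[_ C0] _ _] := extremal_tableau_immaculate s0.
rewrite (sumn_take_content m T0 Tb).
rewrite (sumn_take_content m C0 (extremal_tableau_content a0)).
apply: row_dominance => [|i k iT]; first by rewrite size_extremal -sT size_map.
exact: reverse_immaculate_row_count.
Qed.

Lemma reverse_immaculate_extremal a T : 0 \notin a ->
  rs_reverse_immaculate (rev a) T -> has_content T (beta_omega a) ->
  T = extremal_tableau (rev a).
Proof.
move=> a0 Ta Tb; have s0 : 0 \notin rev a by rewrite mem_rev.
have [[sT T0] _ rT] := Ta; have [[_ C0] _ rC] := extremal_tableau_immaculate s0.
have sz : size T = size (extremal_tableau (rev a)).
  by rewrite size_extremal -sT size_map.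
apply: (@eq_from_nth _ [::]) => // i iT.
apply: (@sorted_eq _ gtn).
- exact: gtn_trans.
- by move=> x y /=; lia.
- exact: allP rT _ (mem_nth _ iT).
- by apply: (allP rC); apply: mem_nth; rewrite -sz.
- apply: row_dominance_perm => // [j m|m]; first exact: reverse_immaculate_row_count.
  rewrite -(sumn_take_content m T0 Tb).
  by rewrite -(sumn_take_content m C0 (extremal_tableau_content a0)).
Qed.

Lemma reverse_K_dominated a b : 0 \notin a -> reverse_K (rev a) b != 0 ->
  dominated b (beta_omega a).
Proof.
move=> a0 Rab; apply: contrapT => nd; move/eqP: Rab; apply.
rewrite /reverse_K; suff -> : [set T | rs_reverse_immaculate (rev a) T
      /\ has_content T b]%classic = set0 by rewrite fset_set0 cardfs0.
apply/seteqP; split=> // T /= [Ta Tb].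
by apply: nd; exact: reverse_immaculate_dominated Ta Tb.
Qed.

Lemma reverse_K_beta_omega a : 0 \notin a -> reverse_K (rev a) (beta_omega a) = 1.
Proof.
move=> a0; rewrite /reverse_K; suff -> : [set T | rs_reverse_immaculate (rev a) T
      /\ has_content T (beta_omega a)]%classic = [set extremal_tableau (rev a)]%classic
  by rewrite fset_set1 cardfs1.
apply/seteqP; split=> T /=; last first.
  move=> ->; split; last exact: extremal_tableau_content.
  by apply: extremal_tableau_immaculate; rewrite mem_rev.
by move=> [Ta Tb]; exact: reverse_immaculate_extremal.
Qed.

(** * Coefficients of monomials *)

Lemma monomE i a v : uniq i -> size i = size a ->
  monom i a v = nth 0 a (index v i).
Proof.
rewrite /monom; elim: i a => [|x i IHi] [|y a] //=.
  by rewrite big_nil mset0E.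
move=> /andP[xi ui] [sz]; rewrite big_cons /= msetE2 msetnE.
rewrite IHi // eq_sym; case: eqP => [<-|//].
by rewrite (memNindex xi) nth_default ?sz // addn0.
Qed.

(** The support of the monomial gives the variables, in increasing order, and
    its exponents give the composition. *)
Lemma monom_inj i a b : 0 \notin a -> 0 \notin b -> size i = size a ->
  sorted ltn i -> monom i a = monom (iota 0 (size b)) b ->
  i = iota 0 (size b) /\ a = b.
Proof.
move=> a0 b0 sz srt E.
have ui := sorted_uniq ltn_trans ltnn srt.
have mE v : nth 0 a (index v i) = nth 0 b (index v (iota 0 (size b))).
  by rewrite -!monomE ?iota_uniq ?size_iota // E.
have iE : i = iota 0 (size b).
  apply: (irr_sorted_eq ltn_trans ltnn) => // [|v]; first exact: iota_ltn_sorted.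
  have memE (j c : seq nat) : 0 \notin c -> size j = size c ->
      (v \in j) = (nth 0 c (index v j) != 0).
    move=> c0 jc; rewrite -index_mem jc; case: ltnP => [lt|ge].
      by apply/esym; apply: contraNneq c0 => <-; exact: mem_nth.
    by rewrite nth_default.
  by rewrite (memE i a) // (memE _ b) ?size_iota // mE.
split=> //; have sab : size a = size b by rewrite -sz iE size_iota.
apply: (@eq_from_nth _ 0) => // j ja; move: (mE j).
have jE : index j (iota 0 (size b)) = j.
  have := @index_uniq _ 0 j (iota 0 (size b)); rewrite size_iota -sab => /(_ ja).
  by rewrite iota_uniq nth_iota -?sab // add0n; exact.
by rewrite iE jE.
Qed.

(** The coefficient of x_0^(b_1) x_1^(b_2) ..., a monomial of M_b that occurs in
    no other M_a. *)
Definition monomial_coef (b : seq nat) (G : qsym) : int :=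
  qsym_val G (monom (iota 0 (size b)) b).

Lemma monomial_coef_additive b : zmod_morphism (monomial_coef b).
Proof. by []. Qed.

HB.instance Definition _ b :=
  GRing.isZmodMorphism.Build qsym int (monomial_coef b) (monomial_coef_additive b).

Lemma monomial_coefMz b G z :
  monomial_coef b (G *~ z)%R = (monomial_coef b G * z)%R.
Proof. by rewrite -[RHS]mulrzz; exact: (raddfMz (monomial_coef b) z G). Qed.

Lemma monomial_coef_QM n (a b : composition n) :
  monomial_coef b (QM a) = (a == b)%:R%R.
Proof.
have a0 := comp_notin0 a; have b0 := comp_notin0 b.
rewrite /monomial_coef /= /M_series; case: (eqVneq a b) => [<-|ne].
  rewrite -(@fsbig_widen _ _ _ _ [set iota 0 (size a)]%classic).
  - by rewrite fsbig_set1 eqxx.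
  - by move=> i /= ->; rewrite size_iota iota_ltn_sorted.
  - move=> i /= [[sz srt] ni]; case: eqP => // /(monom_inj a0 a0 sz srt)[E _].
    by case: ni.
rewrite fsbig1 // => i /= [sz srt]; case: eqP => //.
by move=> /(monom_inj a0 b0 sz srt)[_] /val_inj /eqP; rewrite (negbTE ne).
Qed.

(** * Unitriangularity and leading terms *)

Lemma monomial_coef_sum n (d : composition n -> int) (a : composition n) :
  monomial_coef a (\sum_b QM b *~ d b)%R = d a.
Proof.
rewrite raddf_sum (bigD1 a) //= monomial_coefMz monomial_coef_QM eqxx mul1r.
rewrite big1 ?addr0 // => b /negbTE ne.
by rewrite monomial_coefMz monomial_coef_QM ne mul0r.
Qed.

Lemma monomial_coef_dual_immaculate n (a b : composition n) :
  monomial_coef b (dual_immaculate a) = (K a b)%:R%R.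
Proof.
rewrite /dual_immaculate; under eq_bigr do rewrite pmulrn.
by rewrite monomial_coef_sum natz.
Qed.

(** A numerical function that increases strictly along dominance, for use in
    inductions and maximality arguments. *)
Definition rank n (a : composition n) : nat :=
  #|[pred c : composition n | `[< dominated c a >]]|.

Lemma rank_lt n (b a : composition n) : dominated b a -> b != a -> rank b < rank a.
Proof.
move=> ba ne; apply/proper_card/properP; split.
  apply/fintype.subsetP => c; rewrite !inE => cb; exact: dominated_trans cb ba.
exists a; first by rewrite inE; exact: dominated_refl.
apply/negP; rewrite inE => ab; case/eqP: ne; apply: val_inj.
by apply: dominated_anti; rewrite ?comp_notin0.
Qed.

Definition in_span n (G : qsym) : Prop :=
  exists c, G = (\sum_(b : composition n) dual_immaculate b *~ c b)%R.

Lemma in_spanB n G H : in_span n G -> in_span n H -> in_span n (G - H)%R.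
Proof.
move=> [c ->] [d ->]; exists (fun b => (c b - d b)%R).
by rewrite -sumrB; apply: eq_bigr => b _; rewrite mulrzBr.
Qed.

Lemma in_span0 n : in_span n 0%R.
Proof. by exists (fun=> 0%R); rewrite big1 // => b _; rewrite mulr0z. Qed.

Lemma in_spanD n G H : in_span n G -> in_span n H -> in_span n (G + H)%R.
Proof.
move=> sG sH; rewrite -[H]opprK; apply: in_spanB => //.
by rewrite -sub0r; apply: in_spanB => //; exact: in_span0.
Qed.

Lemma in_spanMz n G z : in_span n G -> in_span n (G *~ z)%R.
Proof.
move=> [c ->]; exists (fun b => (c b * z)%R).
by rewrite mulrz_suml; apply: eq_bigr => b _; rewrite mulrzA.
Qed.

(** By unitriangularity, M_a is the dual immaculate function of [a] minus a
    combination of M_b with [b] strictly below [a]. *)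
Lemma QM_in_span n (a : composition n) : in_span n (QM a).
Proof.
have [m] := ubnP (rank a); elim: m a => [//|m IHm] a; rewrite ltnS => am.
have E : QM a = (dual_immaculate a - \sum_(b | b != a) QM b *+ K a b)%R.
  rewrite /dual_immaculate (bigD1 a) //= K_diag ?comp_notin0 //.
  by rewrite mulr1n addrK.
rewrite E; apply: in_spanB.
  exists (fun b => (b == a)%:R%R); rewrite (bigD1 a) //= eqxx mulr1z.
  by rewrite big1 ?addr0 // => b /negbTE->; rewrite mulr0z.
apply: big_ind => [||b ne]; [exact: in_span0|exact: in_spanD|].
rewrite pmulrn; have [->|Kab] := eqVneq (K a b) 0.
  by rewrite mulr0z; exact: in_span0.
apply/in_spanMz/IHm; apply: leq_trans am; apply: rank_lt => //.
exact: K_dominated (comp_notin0 a) Kab.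
Qed.

(** Comparing coefficients of M_g gives [r g] as the sum of the [c b * K b g],
    where [K b g] vanishes unless [b] dominates [g].  If some [c h] with [h] not
    dominated by [b0] were nonzero, a maximal such [h] would give [r h = c h],
    against the hypothesis on [r]; and for [g = b0] the only surviving term is
    [c b0]. *)
Lemma leading_dominated n (r : composition n -> nat) (b0 : composition n)
    (G : qsym) :
  G = (\sum_b QM b *+ r b)%R ->
  (forall b, r b != 0 -> dominated b b0) -> r b0 = 1 ->
  leading_index (@dual_immaculate n) G b0 /\ qcoef (@dual_immaculate n) G b0 = 1%R.
Proof.
move=> GE rdom rb0; set c := qcoef _ _.
have cE : G = (\sum_b dual_immaculate b *~ c b)%R.
  apply: (@xgetPex _ (fun=> 0%R) [set c | G = (\sum_b dual_immaculate b *~ c b)%R]).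
  rewrite /= GE; apply: (big_ind (in_span n)); [exact: in_span0|exact: in_spanD|].
  by move=> b _; rewrite pmulrn; apply/in_spanMz/QM_in_span.
have rE g : ((r g)%:R : int)%R = (\sum_(b : composition n) (K b g)%:R * c b)%R.
  transitivity (monomial_coef g G); last first.
    rewrite cE raddf_sum; apply: eq_bigr => b _.
    by rewrite /= monomial_coefMz monomial_coef_dual_immaculate.
  by rewrite GE; under eq_bigr do rewrite pmulrn; rewrite monomial_coef_sum natz.
have cdom g : c g != 0%R -> dominated g b0.
  move=> cg; apply: contrapT => ng.
  pose P g := (c g != 0%R) && `[< ~ dominated g b0 >].
  have Pg : P g by rewrite /P cg; exact/asboolP.
  case: (arg_maxnP (@rank n) Pg) => h /andP[ch /asboolP nh] hmax.
  have : (r h)%:R%R = c h.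
    rewrite rE (bigD1 h) //= K_diag ?comp_notin0 // mul1r big1 ?addr0 // => b ne.
    have [->|Kbh] := eqVneq (K b h) 0; first by rewrite mul0r.
    have hb := K_dominated (comp_notin0 b) Kbh.
    have [->|cb] := eqVneq (c b) 0%R; first by rewrite mulr0.
    have [bb0|nb] := pselect (dominated b b0).
      by case: nh; exact: dominated_trans hb bb0.
    have /hmax /= : P b by rewrite /P cb; exact/asboolP.
    by rewrite leqNgt rank_lt // eq_sym.
  have -> : r h = 0 by apply/eqP; apply: contraT => /rdom.
  by move=> /esym /eqP; rewrite (negbTE ch).
have cb0 : c b0 = 1%R.
  have := rE b0; rewrite rb0 (bigD1 b0) //= K_diag ?comp_notin0 // mul1r big1.
    by rewrite addr0.
  move=> b ne; have [->|Kb] := eqVneq (K b b0) 0; first by rewrite mul0r.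
  have [->|cb] := eqVneq (c b) 0%R; first by rewrite mulr0.
  case/eqP: ne; apply: val_inj; apply: dominated_anti; rewrite ?comp_notin0 //.
    exact: cdom.
  exact: K_dominated (comp_notin0 b) Kb.
split=> //; split; first by rewrite -/c cb0.
by move=> g /eqP/cdom; apply: dominated_lexle; exact: comp_notin0.
Qed.

Lemma beta_omega_subproof n (a : composition n) :
  (0 \notin beta_omega a) && (sumn (beta_omega a) == n).
Proof. by rewrite beta_omega_gt0 sumn_beta_omega ?comp_sumn ?comp_notin0 /=. Qed.

Theorem proposition4p9 (omega : {additive qsym -> qsym})
    (omegaF : forall (n : nat) (a : composition n),
        omega (QF a) = QF (comp_tr a))
    (n : nat) (n_gt0 : 0 < n) (a : composition n) :
  exists b : composition n,
    [/\ parts b = beta_omega a,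
        leading_index (@dual_immaculate n) (omega (dual_immaculate a)) b,
        qcoef (@dual_immaculate n) (omega (dual_immaculate a)) b = 1%R
      & (exists! T : seq (seq nat),
           rs_reverse_immaculate (comp_rev a) T /\ has_content T b)
        /\ forall T : seq (seq nat),
             rs_reverse_immaculate (comp_rev a) T /\ has_content T b ->
             forall i, i < size a ->
               nth [::] T i = running_max (comp_rev a) i
                              :: rev (iota 1 (nth 0 (comp_rev a) i - 1))].
Proof.
have a0 := comp_notin0 a.
have uniqT T : rs_reverse_immaculate (rev a) T /\ has_content T (beta_omega a) ->
    T = extremal_tableau (rev a).
  by move=> [Ta Tb]; exact: reverse_immaculate_extremal.
exists (Composition (beta_omega_subproof a)).
have [lead coef] := leading_dominated (omega_dual_immaculate omegaF a)
  (b0 := Composition (beta_omega_subproof a))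
  (fun b => @reverse_K_dominated a b a0) (reverse_K_beta_omega a0).
split=> //; split=> [|T /uniqT-> i ia]; last by rewrite nth_extremal ?size_rev.
exists (extremal_tableau (rev a)); split; last by move=> T /uniqT.
split; last exact: extremal_tableau_content.
by apply: extremal_tableau_immaculate; rewrite mem_rev.
Qed.
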